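(* Let $q$ be a prime power, $\mathbb{F}_q=\{\alpha_1,\ldots,\alpha_q\}$, and let $k\ge3$, $t\ge1$, $h\ge0$, $l\ge0$ be integers with $t+h\le k-1$, $\frac{q-2t+1}{2}<k<\frac{q-t+1}{2}$ and $l\le\frac{q-2k-t}{2}$. Put $n=q-l$ and let $\eta\in\mathbb{F}_q^{*}$. If $\boldsymbol{\alpha}=(\alpha_{i_1},\ldots,\alpha_{i_n})$ with $1\le i_1<\cdots<i_n\le q$, and $\boldsymbol{v}=(v_1,\ldots,v_n)$ with $$v_j=\prod_{\beta\in\mathbb{F}_q\setminus\{\alpha_{i_1},\ldots,\alpha_{i_n}\}}(\alpha_{i_j}-\beta)\quad(j=1,\ldots,n),$$ then $\mathcal{C}_{\mathcal{V}_{k,t,h,\eta}}(\boldsymbol{\alpha},\boldsymbol{v})$ is self-orthogonal.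
   Context: $\alpha_1,\ldots,\alpha_q$ are all the elements of $\mathbb{F}_q$; $\mathbb{F}_q^*=\mathbb{F}_q\setminus\{0\}$. For $h\le k-1$ and $\eta\in\mathbb{F}_q^*$, $$\mathcal{V}_{k,t,h,\eta}=\Big\{\sum_{i=0}^{k-1}a_ix^i+\eta a_hx^{k-1+t}\ \Big|\ a_0,\ldots,a_{k-1}\in\mathbb{F}_q\Big\},$$ $$\mathcal{C}_{\mathcal{V}_{k,t,h,\eta}}(\boldsymbol{\alpha},\boldsymbol{v})=\{(v_1f(\alpha_{i_1}),\ldots,v_nf(\alpha_{i_n}))\mid f\in\mathcal{V}_{k,t,h,\eta}\}.$$ A linear code $\mathcal{C}\subseteq\mathbb{F}_q^n$ is self-orthogonal if $\mathcal{C}\subseteq\mathcal{C}^\perp$ with respect to the Euclidean inner product. Empty products equal $1$. *)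

(* Defs.v *)
From HB Require Import structures.
From mathcomp Require Import all_boot all_order all_algebra all_field.

Set Implicit Arguments.
Unset Strict Implicit.
Unset Printing Implicit Defensive.

Import GRing.Theory.
Local Open Scope ring_scope.

(* As F is finite, V_{k,t,h,eta} is a finite set of polynomials; it is listed
   by its coefficient vectors (a_0, ..., a_{k-1}) and only its membership
   predicate is meaningful.  Typing h as 'I_k encodes h <= k - 1. *)
Definition twisted_polys (F : finFieldType) (k t : nat) (h : 'I_k) (eta : F) :
    seq {poly F} :=
  [seq \sum_(i < k) a i *: 'X^i + (eta * a h) *: 'X^(k - 1 + t)
     | a : {ffun 'I_k -> F}].

Definition twisted_code (F : finFieldType) (n k t : nat) (h : 'I_k) (eta : F)
    (alpha v : 'rV[F]_n) : {set 'rV[F]_n} :=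
  [set:: [seq \row_j (v 0 j * f.[alpha 0 j]) | f <- twisted_polys t h eta]].

Definition dual_code (F : finFieldType) (n : nat) (C : {set 'rV[F]_n}) :
    {set 'rV[F]_n} :=
  [set x : 'rV[F]_n | [forall c in C, \sum_(j < n) x 0 j * c 0 j == 0]].

Definition self_orthogonal (F : finFieldType) (n : nat) (C : {set 'rV[F]_n}) :
    Prop :=
  submod_closed C /\ C \subset dual_code C.

(* Main.v *)
(* With S the evaluation set and P the product of X - beta over beta outside S,
   v_j = P(alpha_j) and P vanishes off S, so the inner product of the codewords
   of f and g is the sum of P^2 f g over the whole field.  That sum only sees
   the coefficients of P^2 f g whose index is a positive multiple of q - 1.
   Writing f = f0 + c X^(k-1+t) and g = g0 + d X^(k-1+t), everything except
   c d P^2 X^(2(k-1+t)) has degree < q - 1, and the monomials of that last term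
   have exponents strictly between q - 1 and 2(q - 1). *)
Require Import Defs.
From HB Require Import structures.
From mathcomp Require Import all_boot all_order all_algebra all_field.
From mathcomp Require Import zify ring.

Set Implicit Arguments.
Unset Strict Implicit.
Unset Printing Implicit Defensive.

Import GRing.Theory.
Local Open Scope ring_scope.

Lemma finField_expf_card_pred (F : finFieldType) (a : F) :
  a != 0 -> a ^+ #|F|.-1 = 1.
Proof.
move=> a0; apply: (mulfI a0); rewrite -exprS prednK ?expf_card ?mulr1 //.
by apply/card_gt0P; exists 0.
Qed.

(** A root count, with no appeal to cyclicity of the unit group. If no such [a] existed, then with
    [r] the remainder of [m] modulo q - 1, where 0 < r < q - 1, all q - 1 nonzero elements would be
    roots of X^r - 1. *)
Lemma finField_exists_expf_neq1 (F : finFieldType) (m : nat) :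
  ~~ (#|F|.-1 %| m)%N -> exists2 a : F, a != 0 & a ^+ m != 1.
Proof.
move=> ndvd; apply/exists_inP; apply: contraNT ndvd.
rewrite negb_exists_in => /forall_inP am1.
have q_gt1 : (1 < #|F|)%N := finNzRing_gt1 F.
have q1_gt0 : (0 < #|F|.-1)%N by rewrite -ltnS prednK // ltnW.
rewrite /dvdn; set r := (m %% _)%N; rewrite -[_ == _]negbK -lt0n.
apply/negP => r_gt0.
have Xr_neq0 : 'X^r - 1 != 0 :> {poly F} by rewrite -size_poly_eq0 size_XnsubC.
have := @max_poly_roots F _ (enum [set~ (0 : F)]) Xr_neq0.
rewrite size_XnsubC // enum_uniq -cardE cardsC1 ltnS leqNgt ltn_mod q1_gt0.
move=> all_roots.
suff /all_roots /(_ isT) : all (root ('X^r - 1)) (enum [set~ (0 : F)]) by [].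
apply/allP => a; rewrite mem_enum !inE => a0.
have := am1 a a0; rewrite negbK => /eqP am.
rewrite rootE !hornerE subr_eq0 -am (divn_eq m #|F|.-1) exprD mulnC exprM.
by rewrite finField_expf_card_pred // expr1n mul1r.
Qed.

(** For positive [m], multiplication by [a] permutes F and scales the sum by [a ^+ m], which can be
    chosen different from 1. The implication also admits [m = 0], where every term is 1, including
    the one at [x = 0]. *)
Lemma finField_sum_expf (F : finFieldType) (m : nat) :
  (0 < m)%N ==> ~~ (#|F|.-1 %| m)%N -> \sum_(x : F) x ^+ m = 0.
Proof.
case: m => [_|m /= /finField_exists_expf_neq1 [a a0 am1]].
  (* Translation by 1 permutes F, so the sum of x equals the sum of x + 1. *)
  apply: (@addrI _ (\sum_(x : F) x)); rewrite -big_split addr0 /=.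
  by rewrite [RHS](reindex_inj (addIr 1)).
have : (a ^+ m.+1 - 1) * \sum_(x : F) x ^+ m.+1 = 0.
  rewrite mulrBl mul1r {2}(reindex_inj (mulfI a0)) mulr_sumr.
  by under [X in _ - X]eq_bigr do rewrite exprMn; rewrite subrr.
by move/eqP; rewrite mulf_eq0 subr_eq0 (negPf am1) => /eqP.
Qed.

Lemma finField_sum_horner (F : finFieldType) (p : {poly F}) :
  (forall m, (0 < m)%N -> (#|F|.-1 %| m)%N -> p`_m = 0) ->
  \sum_(x : F) p.[x] = 0.
Proof.
move=> p0; under eq_bigr do rewrite horner_coef.
rewrite exchange_big big1 //= => m _; rewrite -mulr_sumr.
have [|/negPf] := boolP ((0 < m)%N ==> ~~ (#|F|.-1 %| m)%N).
  by move/finField_sum_expf->; rewrite mulr0.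
by move/negbT; rewrite negb_imply negbK => /andP[m0 dm]; rewrite p0 // mul0r.
Qed.

Lemma finField_sum_horner_gap (F : finFieldType) (e : nat) (A B : {poly F}) :
  (size A <= #|F|.-1)%N -> (#|F|.-1 < e)%N ->
  (e + size B <= #|F|.-1 * 2)%N ->
  \sum_(x : F) (A + 'X^e * B).[x] = 0.
Proof.
move=> sA lte leB; apply: finField_sum_horner => m m_gt0 dvdm.
have le_m : (#|F|.-1 <= m)%N := dvdn_leq m_gt0 dvdm.
rewrite coefD (nth_default _ (leq_trans sA le_m)) add0r coefXnM.
case: ltnP => // le_em; rewrite nth_default //.
(* The multiple 0 contradicts [m_gt0], and q - 1 lies below [e]. Every further multiple is at least
   2(q - 1), beyond the last coefficient of ['X^e * B]. *)
case/dvdnP: dvdm => -[|[|c]] def_m; [lia | lia |].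
rewrite leq_subRL //; apply: leq_trans leB _.
by rewrite def_m mulnC leq_mul.
Qed.

Lemma sum_sqr_prod_compl (F : finFieldType) (S : {set F}) (p : {poly F}) :
  \sum_(x in S) (\prod_(b in ~: S) (x - b)) ^+ 2 * p.[x] =
  \sum_(x : F) ((\prod_(b in ~: S) ('X - b%:P)) ^+ 2 * p).[x].
Proof.
rewrite [RHS](bigID (mem S)) /= [X in _ + X]big1 ?addr0 => [|x xS].
  apply: eq_bigr => x _; rewrite hornerM horner_exp horner_prod.
  by under [in RHS]eq_bigr do rewrite hornerXsubC.
by rewrite (bigD1 x) ?inE //= hornerM horner_exp hornerM hornerXsubC subrr
           mul0r expr0n mul0r.
Qed.

Lemma sum_sqr_prod_compl_twisted (F : finFieldType) (S : {set F})
    (k t : nat) (f g : {poly F}) (c d : F) :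
  (0 < k)%N -> (t < k)%N ->
  (#|F| + 1 < 2 * k + 2 * t)%N ->
  (2 * #|~: S| + 2 * k + t <= #|F|)%N ->
  (size f <= k)%N -> (size g <= k)%N ->
  \sum_(x in S) (\prod_(b in ~: S) (x - b)) ^+ 2 *
    ((f + c *: 'X^(k - 1 + t)) * (g + d *: 'X^(k - 1 + t))).[x] = 0.
Proof.
move=> k_gt0 ltk lo up sf sg; rewrite sum_sqr_prod_compl.
set P := \prod_(b in _) _; set e := (k - 1 + t)%N.
have sP2 : (size (P ^+ 2) <= (2 * #|~: S|).+1)%N.
  apply: leq_trans (size_poly_exp_leq _ _) _.
  by rewrite /P -big_enum size_prod_XsubC -cardE mulnC.
have -> : P ^+ 2 * ((f + c *: 'X^e) * (g + d *: 'X^e)) =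
    P ^+ 2 * (f * g + (c *: g + d *: f) * 'X^e)
      + 'X^(e + e) * ((c * d) *: P ^+ 2).
  by rewrite -!mul_polyC exprD rmorphM /=; ring.
have s_fg : (size (c *: g + d *: f)%R <= k)%N.
  rewrite (leq_trans (size_polyD _ _)) // geq_max.
  by rewrite !(leq_trans (size_scale_leq _ _)).
(* Write s for the size of the complement of S. By [up], the low part has size at most 2s + 2k + t -
   1 <= q - 1. By [lo], 2e = 2k + 2t - 2 > q - 1. Finally 2e + 2s + 1 <= q + t - 1 <= 2(q - 1),
   again by [up]. *)
apply: finField_sum_horner_gap.
- apply: leq_trans (size_polyMleq _ _) _.
  (* The mixed term dominates: [f * g] has size at most 2k - 1 <= k + e. *)
  have s_low : (size (f * g + (c *: g + d *: f) * 'X^e)%R <= k + e)%N.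
    rewrite (leq_trans (size_polyD _ _)) // geq_max.
    apply/andP; split; apply: leq_trans (size_polyMleq _ _) _.
      by rewrite /e; lia.
    by rewrite size_polyXn; lia.
  by rewrite -subn1 leq_subLR (leq_trans (leq_add sP2 s_low)) // /e; lia.
- by rewrite /e; lia.
- have sB := leq_trans (size_scale_leq (c * d) (P ^+ 2)) sP2.
  by rewrite (leq_trans (leq_add (leqnn _) sB)) // /e; lia.
Qed.

Lemma size_sum_ordXn (R : nzRingType) (k : nat) (a : 'I_k -> R) :
  (size (\sum_(i < k) a i *: 'X^i)%R <= k)%N.
Proof.
apply: leq_trans (size_sum _ _ _) _; apply/bigmax_leqP => i _.
by rewrite (leq_trans (size_scale_leq _ _)) // size_polyXn.
Qed.

Lemma twisted_codeP (F : finFieldType) (n k t : nat) (h : 'I_k) (eta : F)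
    (alpha v c : 'rV[F]_n) :
  reflect (exists a : {ffun 'I_k -> F},
             c = \row_j (v 0 j * (\sum_(i < k) a i *: 'X^i
                   + (eta * a h) *: 'X^(k - 1 + t)).[alpha 0 j]))
          (c \in twisted_code t h eta alpha v).
Proof.
rewrite inE; apply: (iffP mapP) => [[f /imageP[a _ ->] ->]|[a ->]].
  by exists a.
by eexists; first by apply: image_f; exact: (isT : a \in predT).
Qed.

(** The twist coefficient [eta * a h] is linear in [a], so codewords combine as their coefficient
    vectors do. *)
Lemma twisted_code_submod (F : finFieldType) (n k t : nat) (h : 'I_k)
    (eta : F) (alpha v : 'rV[F]_n) :
  submod_closed (twisted_code t h eta alpha v).
Proof.
split=> [|x _ _ /twisted_codeP[a ->] /twisted_codeP[b ->]].
  apply/twisted_codeP; exists [ffun=> 0]; apply/rowP => j; rewrite !mxE ffunE.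
  by rewrite mulr0 scale0r addr0 big1 ?horner0 ?mulr0 // => i _;
    rewrite ffunE scale0r.
apply/twisted_codeP; exists [ffun i => x * a i + b i].
apply/rowP => j; rewrite !mxE ffunE.
under [in RHS]eq_bigr do rewrite ffunE scalerDl -scalerA.
by rewrite big_split /= -scaler_sumr !hornerD !hornerZ; ring.
Qed.

Theorem theorem4p2 (F : finFieldType) (q : nat) (hq : #|F| = q)
  (enumF : 'I_q -> F) (henum : bijective enumF)
  (k t l n : nat) (h : 'I_k) (eta : F)
  (hk : (3 <= k)%N) (ht : (1 <= t)%N) (hth : (t + h <= k - 1)%N)
  (hk_lower : (q + 1 < 2 * k + 2 * t)%N)
  (hk_upper : (2 * k + t < q + 1)%N)
  (hl : (2 * l + 2 * k + t <= q)%N)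
  (hn : n = (q - l)%N)
  (heta : eta != 0)
  (i : 'I_n -> 'I_q)
  (hi : forall j1 j2 : 'I_n, (j1 < j2)%N -> (i j1 < i j2)%N)
  (alpha v : 'rV[F]_n)
  (halpha : forall j : 'I_n, alpha 0 j = enumF (i j))
  (hv : forall j : 'I_n,
     v 0 j = \prod_(beta in ~: [set alpha 0 s | s : 'I_n]) (alpha 0 j - beta)) :
  self_orthogonal (twisted_code t h eta alpha v).
Proof.
split; first exact: twisted_code_submod.
apply/subsetP => _ /twisted_codeP[a ->]; rewrite inE.
apply/forall_inP => _ /twisted_codeP[b ->]; apply/eqP.
set S := [set alpha 0 s | s : 'I_n] in hv.
have i_inj : injective i.
  move=> j1 j2 eq_i; apply/val_inj.
  by case: (ltngtP j1 j2) => // /hi; rewrite eq_i ltnn.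
have alpha_inj : injective (alpha 0).
  by move=> j1 j2; rewrite !halpha => /(bij_inj henum) /i_inj.
(* The truncated difference q - (q - l) equals l because [hl] forces l <= q. *)
have card_compl : #|~: S| = l.
  by rewrite cardsCs setCK card_imset // card_ord hq hn subKn; lia.
(* Each codeword contributes one factor [v 0 j], hence the squared product; injectivity of [alpha]
   turns the sum over S into a sum over positions. *)
rewrite -[RHS](@sum_sqr_prod_compl_twisted F S k t (\sum_(s < k) a s *: 'X^s)
  (\sum_(s < k) b s *: 'X^s) (eta * a h) (eta * b h)).
- rewrite big_imset /=; last by move=> ? ? _ _; exact: alpha_inj.
  by apply: eq_bigr => j _; rewrite !mxE hv hornerM; ring.
- lia.
- lia.
- lia.
- lia.
- exact: size_sum_ordXn.
- exact: size_sum_ordXn.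
Qed.
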